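(* Let $\mathfrak{g}$ be any finite dimensional Lie algebra over $k$ and let $(\mathfrak{q},\beta,\varphi)$ be any $\mathfrak{g}$-quasi-Frobenius Lie algebra. Let $D(\mathfrak{g})$ be the Drinfeld double of the Lie bialgebra $(\mathfrak{g},\gamma)$ where $\gamma\equiv 0$. Define $\rho: D(\mathfrak{g})\rightarrow \mathfrak{gl}(\mathfrak{q})$ by $\rho(x+\xi)=\varphi(x)$ for all $x\in \mathfrak{g}$, $\xi\in \mathfrak{g}^\ast$. Then $(\mathfrak{q},\beta,\rho)$ is a $D(\mathfrak{g})$-quasi-Frobenius Lie algebra.
   Context: $k$ is a field of characteristic zero. A quasi-Frobenius Lie algebra over $k$ is a pair $(\mathfrak{q},\beta)$ where $\mathfrak{q}$ is a Lie algebra over $k$ and $\beta:\mathfrak{q}\times\mathfrak{q}\to k$ is a nondegenerate skew-symmetric bilinear form satisfying the 2-cocycle condition $\beta([u,v],w)+\beta([v,w],u)+\beta([w,u],v)=0$ for all $u,v,w\in\mathfrak{q}$. For a finite dimensional Lie algebra $\mathfrak{h}$ over $k$, an $\mathfrak{h}$-quasi-Frobenius Lie algebra is a triple $(\mathfrak{q},\beta,\rho)$ where $(\mathfrak{q},\beta)$ is a quasi-Frobenius Lie algebra and $\rho:\mathfrak{h}\to\mathfrak{gl}(\mathfrak{q})$, $x\mapsto\rho_x=\rho(x)$, is a representation such that each $\rho_x$ is a derivation of $\mathfrak{q}$ and $\beta(\rho_x(u),v)+\beta(u,\rho_x(v))=0$ for all $x\in\mathfrak{h}$, $u,v\in\mathfrak{q}$.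 The Drinfeld double $D(\mathfrak{g})$ of a finite dimensional Lie bialgebra $(\mathfrak{g},\gamma)$ (a Lie algebra $\mathfrak{g}$ with cobracket $\gamma:\mathfrak{g}\to\mathfrak{g}\wedge\mathfrak{g}$) is, as a Lie algebra, the vector space $\mathfrak{g}\oplus\mathfrak{g}^\ast$ containing $\mathfrak{g}$ and $\mathfrak{g}^\ast$ (with bracket $[\xi,\eta](x)=(\xi\otimes\eta)(\gamma(x))$, hence abelian when $\gamma\equiv0$) as Lie subalgebras, with mixed bracket $[x,\xi]=ad^\ast_x\xi-ad^\ast_\xi x$ for $x\in\mathfrak{g}$, $\xi\in\mathfrak{g}^\ast$, where $ad^\ast_x:=-(ad_x)^t:\mathfrak{g}^\ast\to\mathfrak{g}^\ast$ and $ad^\ast_\xi:=-(ad_\xi)^t:\mathfrak{g}\to\mathfrak{g}$. Elements of $D(\mathfrak{g})$ are written $x+\xi$ with $x\in\mathfrak{g}$, $\xi\in\mathfrak{g}^\ast$. *)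

(* Defs.v *)
From HB Require Import structures.
From mathcomp Require Import all_boot all_order all_algebra ring.

Set Implicit Arguments.
Unset Strict Implicit.
Unset Printing Implicit Defensive.
Import GRing.Theory.
Local Open Scope ring_scope.

HB.mixin Record Lmodule_isLieAlgebra (K : fieldType) L of GRing.Lmodule K L := {
  lie_bracket : {bilinear L -> L -> L};
  lie_alternating : forall x, lie_bracket x x = 0;
  lie_jacobi : forall x y z, lie_bracket x (lie_bracket y z) +
    lie_bracket y (lie_bracket z x) + lie_bracket z (lie_bracket x y) = 0
}.

#[short(type="lieAlgType")]
HB.structure Definition LieAlgebra (K : fieldType) :=
  {L of GRing.Lmodule K L & Lmodule_isLieAlgebra K L}.

#[short(type="finLieAlgType")]
HB.structure Definition FinLieAlgebra (K : fieldType) :=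
  {L of LieAlgebra K L & Vector K L}.

Notation "[ 'lie' x , y ]" := (lie_bracket x y)
  (at level 0, format "[ 'lie'  x ,  y ]") : ring_scope.

(* Nondegenerate means: trivial radical. No finiteness is assumed on [q]. *)
Record quasi_Frobenius (K : fieldType) (q : lieAlgType K) (beta : {biscalar q})
  : Prop := QuasiFrobenius {
  qF_skew : forall u v, beta u v = - beta v u;
  qF_nondegenerate : forall u, (forall v, beta u v = 0) -> u = 0;
  qF_cocycle : forall u v w,
    beta [lie u, v] w + beta [lie v, w] u + beta [lie w, u] v = 0
}.

(* [{linear q -> q}] plays the role of gl(q), which is not an [lmodType] in the
   library when [q] may be infinite dimensional; hence linearity of [rho] and
   the commutator are written pointwise. *)
Record lie_representation (K : fieldType) (h q : lieAlgType K)
  (rho : h -> {linear q -> q}) : Prop := LieRepresentation {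
  lie_rep_linear : forall a x y u,
    rho (a *: x + y) u = a *: rho x u + rho y u;
  lie_rep_bracket : forall x y u,
    rho [lie x, y] u = rho x (rho y u) - rho y (rho x u)
}.

Definition lie_derivation (K : fieldType) (q : lieAlgType K) (d : q -> q) :=
  forall u v, d [lie u, v] = [lie d u, v] + [lie u, d v].

Record equivariant_quasi_Frobenius (K : fieldType) (h : finLieAlgType K)
  (q : lieAlgType K) (beta : {biscalar q}) (rho : h -> {linear q -> q})
  : Prop := EquivariantQuasiFrobenius {
  eqF_quasi_Frobenius : quasi_Frobenius beta;
  eqF_representation : lie_representation rho;
  eqF_derivation : forall x, lie_derivation (rho x);
  eqF_invariant : forall x u v, beta (rho x u) v + beta u (rho x v) = 0
}.

Section Dual.
Variables (K : fieldType).

Definition dual (V : vectType K) : vectType K := 'Hom(V, K^o).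

Definition transpose (V W : vectType K) (f : 'Hom(V, W))
  : 'Hom(dual W, dual V) := linfun (fun xi : dual W => (xi \o f)%VF : dual V).

Definition dual_eval (V : vectType K) (x : V) : dual (dual V) :=
  linfun (fun xi : dual V => xi x).

Definition bidual (V : vectType K) : 'Hom(V, dual (dual V)) :=
  linfun (@dual_eval V).

(* V (x) V for finite dimensional V: a (x) b is the bilinear form
   xi, eta |-> xi a * eta b on the dual, and (xi (x) eta) t is [t xi eta]. *)
Definition tensor2 (V : vectType K) : vectType K :=
  'Hom(dual V, dual (dual V)).

Lemma transposeE (V W : vectType K) (f : 'Hom(V, W)) (xi : dual W) x :
  transpose f xi x = xi (f x).
Proof.
pose F (xi : dual W) : dual V := (xi \o f)%VF.
have FL : linear F.
  by move=> a u v; apply/lfunP=> y; rewrite /F /= !lfunE /= !lfunE /= !lfunE.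
pose FM := GRing.isLinear.Build _ _ _ _ F FL.
pose FF : {linear _ -> _} := HB.pack F FM.
by rewrite /transpose (lfunE FF) /= comp_lfunE.
Qed.

Lemma dual_evalE (V : vectType K) (x : V) (xi : dual V) :
  dual_eval x xi = xi x.
Proof.
pose F (xi : dual V) : K^o := xi x.
have FL : linear F by move=> a u v; rewrite /F !lfunE /= !lfunE.
pose FM := GRing.isLinear.Build _ _ _ _ F FL.
pose FF : {linear _ -> _} := HB.pack F FM.
exact: (lfunE FF).
Qed.

Lemma bidualE (V : vectType K) (x : V) (xi : dual V) : bidual V x xi = xi x.
Proof.
have FL : linear (@dual_eval V).
  move=> a u v; apply/lfunP=> y.
  by rewrite !lfunE /= !lfunE /= !dual_evalE linearP.
pose FM := GRing.isLinear.Build _ _ _ _ _ FL.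
pose FF : {linear _ -> _} := HB.pack (@dual_eval V) FM.
by rewrite /bidual (lfunE FF) /= dual_evalE.
Qed.

Lemma dual_separates (V : vectType K) (x y : V) :
  (forall xi : dual V, xi x = xi y) -> x = y.
Proof.
move=> exy; rewrite (coord_vbasis (memvf x)) (coord_vbasis (memvf y)).
apply: eq_bigr => i _; congr (_ *: _).
have := exy (linfun (coord (vbasis fullv) i : V -> K^o)).
by rewrite !lfunE.
Qed.

Lemma lker_bidual (V : vectType K) : lker (bidual V) == 0%VS.
Proof.
apply/lker0P => x y exy; apply: dual_separates => xi.
by rewrite -(bidualE x) -(bidualE y) exy.
Qed.

Lemma dim_dual (V : vectType K) : dim (dual V) = dim V.
Proof. by rewrite -[LHS]/(dim V * 1)%N muln1. Qed.

Lemma bidualVE (V : vectType K) (t : dual (dual V)) (xi : dual V) :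
  xi ((bidual V)^-1%VF t) = t xi.
Proof.
have bidual_onto : limg (bidual V) = fullv.
  apply/eqP; rewrite eqEdim subvf /= limg_dim_eq; last first.
    by rewrite (eqP (lker_bidual V)) capv0.
  by rewrite !dimvf !dim_dual.
by rewrite -[LHS]bidualE limg_lfunVK // bidual_onto memvf.
Qed.

End Dual.

Section Bialgebra.
Variables (K : fieldType) (g : finLieAlgType K).

Definition lie_ad (x : g) : 'Hom(g, g) := linfun (lie_bracket x).

(* the action of x on g (x) g: x . (a (x) b) = [x,a] (x) b + a (x) [x,b] *)
Definition tensor2_act (x : g) (t : tensor2 g) (xi eta : dual g) : K :=
  t (transpose (lie_ad x) xi) eta + t xi (transpose (lie_ad x) eta).

Definition dual_bracket (gamma : 'Hom(g, tensor2 g)) (xi eta : dual g)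
  : dual g := linfun (fun x : g => gamma x xi eta).

Record lieCobracket := LieCobracket {
  cobracket :> 'Hom(g, tensor2 g);
  cobracket_alternating : forall x xi, cobracket x xi xi = 0;
  cobracket_coJacobi : forall xi eta zeta : dual g,
    dual_bracket cobracket xi (dual_bracket cobracket eta zeta) +
    dual_bracket cobracket eta (dual_bracket cobracket zeta xi) +
    dual_bracket cobracket zeta (dual_bracket cobracket xi eta) = 0;
  cobracket_cocycle : forall x y xi eta, cobracket [lie x, y] xi eta =
    tensor2_act x (cobracket y) xi eta - tensor2_act y (cobracket x) xi eta
}.

Lemma dual_bracketE (gamma : 'Hom(g, tensor2 g)) xi eta x :
  dual_bracket gamma xi eta x = gamma x xi eta.
Proof.
pose F (x : g) : K^o := gamma x xi eta.
have FL : linear F.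
  by move=> a u v; rewrite /F linearP !(add_lfunE, scale_lfunE).
pose FM := GRing.isLinear.Build _ _ _ _ F FL.
pose FF : {linear _ -> _} := HB.pack F FM.
exact: (lfunE FF).
Qed.

Lemma zero_cobracket_alternating x xi :
  (0 : 'Hom(g, tensor2 g)) x xi xi = 0.
Proof. by rewrite !zero_lfunE. Qed.

Lemma dual_bracket0 xi eta : dual_bracket 0 xi eta = 0.
Proof. by apply/lfunP => x; rewrite dual_bracketE !zero_lfunE. Qed.

Lemma zero_cobracket_coJacobi (xi eta zeta : dual g) :
  dual_bracket 0 xi (dual_bracket 0 eta zeta) +
  dual_bracket 0 eta (dual_bracket 0 zeta xi) +
  dual_bracket 0 zeta (dual_bracket 0 xi eta) = 0.
Proof. by rewrite !dual_bracket0 !addr0. Qed.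

Lemma zero_cobracket_cocycle x y xi eta :
  (0 : 'Hom(g, tensor2 g)) [lie x, y] xi eta =
  tensor2_act x ((0 : 'Hom(g, tensor2 g)) y) xi eta -
  tensor2_act y ((0 : 'Hom(g, tensor2 g)) x) xi eta.
Proof. by rewrite /tensor2_act !zero_lfunE !addr0 subr0. Qed.

Definition zero_cobracket : lieCobracket :=
  LieCobracket zero_cobracket_alternating zero_cobracket_coJacobi
    zero_cobracket_cocycle.

Definition coad (x : g) : 'Hom(dual g, dual g) := - transpose (lie_ad x).

Definition dual_ad (gamma : lieCobracket) (xi : dual g)
  : 'Hom(dual g, dual g) := linfun (dual_bracket gamma xi).

Definition dual_coad (gamma : lieCobracket) (xi : dual g) : 'Hom(g, g) :=
  ((bidual g)^-1 \o (- transpose (dual_ad gamma xi)) \o bidual g)%VF.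

(* The pair (x, xi) is the element written x + xi. *)
Definition drinfeld_double (gamma : lieCobracket) : Type := (g * dual g)%type.

(* [x + xi, y + eta]
     = [x, y] + [xi, eta] + (ad*_x eta - ad*_eta x) - (ad*_y xi - ad*_xi y) *)
Definition double_bracket (gamma : lieCobracket) (X Y : g * dual g)
  : g * dual g :=
  ([lie X.1, Y.1] - dual_coad gamma Y.2 X.1 + dual_coad gamma X.2 Y.1,
   dual_bracket gamma X.2 Y.2 + coad X.1 Y.2 - coad Y.1 X.2).

HB.instance Definition _ gamma :=
  Vector.copy (drinfeld_double gamma) (g * dual g)%type.

Section DoubleLie.
Variable gamma : lieCobracket.

Lemma lie_adE x y : lie_ad x y = [lie x, y].
Proof. by rewrite /lie_ad lfunE. Qed.

Lemma coadE x (xi : dual g) y : coad x xi y = - xi [lie x, y].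
Proof. by rewrite /coad opp_lfunE opp_lfunE transposeE lie_adE. Qed.

Lemma dual_adE xi eta : dual_ad gamma xi eta = dual_bracket gamma xi eta.
Proof.
have FL : linear (dual_bracket gamma xi).
  move=> a u v; apply/lfunP => y.
  by rewrite add_lfunE scale_lfunE !dual_bracketE linearP.
pose FM := GRing.isLinear.Build _ _ _ _ _ FL.
pose FF : {linear _ -> _} := HB.pack (dual_bracket gamma xi) FM.
exact: (lfunE FF).
Qed.

Lemma dual_coadE xi x (zeta : dual g) :
  zeta (dual_coad gamma xi x) = - gamma x xi zeta.
Proof.
rewrite /dual_coad !comp_lfunE bidualVE !opp_lfunE transposeE bidualE.
by rewrite dual_adE dual_bracketE.
Qed.

Lemma hom_D (U V : vectType K) (f : 'Hom(U, V)) x y : f (x + y) = f x + f y.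
Proof. exact: linearD. Qed.

Lemma hom_N (U V : vectType K) (f : 'Hom(U, V)) x : f (- x) = - f x.
Proof. exact: linearN. Qed.

Lemma hom_Z (U V : vectType K) (f : 'Hom(U, V)) a x : f (a *: x) = a *: f x.
Proof. exact: linearZ. Qed.

Lemma lie_Dl (x y z : g) : [lie x + y, z] = [lie x, z] + [lie y, z].
Proof. exact: linearDl. Qed.

Lemma lie_Dr (x y z : g) : [lie z, x + y] = [lie z, x] + [lie z, y].
Proof. exact: linearDr. Qed.

Lemma lie_Nl (x y : g) : [lie - x, y] = - [lie x, y].
Proof. exact: linearNl. Qed.

Lemma lie_Nr (x y : g) : [lie y, - x] = - [lie y, x].
Proof. exact: linearNr. Qed.

Lemma lie_Zl a (x y : g) : [lie a *: x, y] = a *: [lie x, y].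
Proof. exact: linearZl_LR. Qed.

Lemma lie_Zr a (x y : g) : [lie y, a *: x] = a *: [lie y, x].
Proof. exact: linearZr. Qed.

Definition multilinE := (hom_D, hom_N, hom_Z, add_lfunE, opp_lfunE,
  scale_lfunE, lie_Dl, lie_Dr, lie_Nl, lie_Nr, lie_Zl, lie_Zr).

Definition double_evalE := (dual_bracketE, coadE, dual_coadE).

Lemma lie_anti (x y : g) : [lie x, y] = - [lie y, x].
Proof.
apply/eqP; rewrite -addr_eq0; apply/eqP.
have := lie_alternating (x + y).
by rewrite linearDr !linearDl /= !lie_alternating add0r addr0 addrC.
Qed.

Lemma lie_jacobil (x y z : g) :
  [lie [lie x, y], z] = [lie x, [lie y, z]] - [lie y, [lie x, z]].
Proof.
have := lie_jacobi x y z.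
rewrite [[lie z, [lie x, y]]]lie_anti [[lie z, x]]lie_anti.
by move/eqP; rewrite linearNr /= subr_eq0 => /eqP.
Qed.

Lemma cobracket_anti x (xi eta : dual g) :
  gamma x xi eta = - gamma x eta xi.
Proof.
apply/eqP; rewrite -addr_eq0; apply/eqP.
have := cobracket_alternating gamma x (xi + eta).
rewrite !(hom_D, add_lfunE) !cobracket_alternating.
by rewrite add0r addr0 addrC.
Qed.

Lemma dual_bracket_anti (xi eta : dual g) :
  dual_bracket gamma xi eta = - dual_bracket gamma eta xi.
Proof.
by apply/lfunP=> x; rewrite opp_lfunE !dual_bracketE cobracket_anti.
Qed.

Lemma cobracket_coJacobil x (xi eta zeta : dual g) :
  gamma x (dual_bracket gamma xi eta) zeta =
  gamma x xi (dual_bracket gamma eta zeta) -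
  gamma x eta (dual_bracket gamma xi zeta).
Proof.
have /lfunP/(_ x) := cobracket_coJacobi gamma xi eta zeta.
rewrite !add_lfunE !dual_bracketE zero_lfunE.
rewrite [gamma x zeta _]cobracket_anti [dual_bracket _ zeta xi]dual_bracket_anti.
by move/eqP; rewrite linearN /= subr_eq0 => /eqP.
Qed.

Lemma lie_dual_coadr (zeta xi : dual g) x y :
  zeta [lie y, dual_coad gamma xi x] =
  - gamma x xi (transpose (lie_ad y) zeta).
Proof. by rewrite -dual_coadE transposeE lie_adE. Qed.

Lemma lie_dual_coadl (zeta xi : dual g) x y :
  zeta [lie dual_coad gamma xi x, y] =
  gamma x xi (transpose (lie_ad y) zeta).
Proof. by rewrite lie_anti linearN /= lie_dual_coadr opprK. Qed.

Lemma cobracket_dual_coad x (xi eta zeta : dual g) :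
  gamma (dual_coad gamma xi x) eta zeta =
  - gamma x xi (dual_bracket gamma eta zeta).
Proof. by rewrite -dual_bracketE dual_coadE. Qed.

Lemma cobracket_cocycle_anti x y (xi eta : dual g) :
  gamma [lie x, y] xi eta =
  gamma y xi (transpose (lie_ad x) eta) -
  gamma y eta (transpose (lie_ad x) xi) -
  (gamma x xi (transpose (lie_ad y) eta) -
   gamma x eta (transpose (lie_ad y) xi)).
Proof.
rewrite cobracket_cocycle /tensor2_act.
rewrite [gamma y (transpose _ _) _]cobracket_anti.
rewrite [gamma x (transpose _ _) _]cobracket_anti.
ring.
Qed.

Lemma double_bracket_bilinear :
  bilinear_for *:%R *:%R
    (double_bracket gamma : drinfeld_double gamma -> drinfeld_double gamma ->
                            drinfeld_double gamma).
Proof.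
split=> -[z zeta] a [x xi] [y eta]; congr pair => /=.
- apply: dual_separates => om.
  rewrite !(multilinE, double_evalE).
  ring.
- apply/lfunP => w.
  rewrite !(multilinE, double_evalE).
  ring.
- apply: dual_separates => om.
  rewrite !(multilinE, double_evalE).
  ring.
- apply/lfunP => w.
  rewrite !(multilinE, double_evalE).
  ring.
Qed.

HB.instance Definition _ := bilinear_isBilinear.Build K
  (drinfeld_double gamma) (drinfeld_double gamma) (drinfeld_double gamma)
  *:%R *:%R (double_bracket gamma) double_bracket_bilinear.

Lemma double_bracket_alternating (X : drinfeld_double gamma) :
  double_bracket gamma X X = 0.
Proof.
case: X => x xi; congr pair => /=.
- by rewrite lie_alternating sub0r addNr.
- apply/lfunP => w.
  rewrite !(multilinE, double_evalE) zero_lfunE cobracket_alternating.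
  ring.
Qed.

Lemma double_bracket_jacobi (X Y Z : drinfeld_double gamma) :
  double_bracket gamma X (double_bracket gamma Y Z) +
  double_bracket gamma Y (double_bracket gamma Z X) +
  double_bracket gamma Z (double_bracket gamma X Y) = 0.
Proof.
case: X Y Z => [x xi] [y eta] [z zeta]; congr pair => /=.
- apply: dual_separates => om.
  rewrite !(multilinE, double_evalE, lie_dual_coadr, cobracket_dual_coad).
  rewrite !(cobracket_cocycle, cobracket_coJacobil) /tensor2_act.
  have -> : [lie x, [lie y, z]] = - [lie y, [lie z, x]] - [lie z, [lie x, y]].
    by rewrite -opprD; apply/eqP; rewrite -addr_eq0 addrA lie_jacobi.
  rewrite !multilinE linear0.
  ring.
- apply/lfunP => w.
  rewrite !(multilinE, double_evalE, lie_dual_coadl, lie_jacobil).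
  rewrite !(multilinE, cobracket_cocycle_anti).
  have /lfunP/(_ w) := cobracket_coJacobi gamma xi eta zeta.
  rewrite !(add_lfunE, dual_bracketE, zero_lfunE) => /eqP.
  rewrite -addrA addr_eq0 => /eqP ->.
  rewrite !(transposeE, lie_adE).
  ring.
Qed.

HB.instance Definition _ := Lmodule_isLieAlgebra.Build K
  (drinfeld_double gamma) double_bracket_alternating double_bracket_jacobi.

End DoubleLie.
End Bialgebra.

(* Main.v *)
(** When the cobracket vanishes, [dual g] acts trivially on [g] by its coadjoint
    action, so the projection of the double onto [g] is a Lie algebra morphism
    (with kernel the abelian ideal [dual g]), and the action of [g] on [q] is
    pulled back along it. *)
Require Import Defs.
From mathcomp Require Import all_boot all_order all_algebra.

Set Implicit Arguments.
Unset Strict Implicit.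
Unset Printing Implicit Defensive.
Import GRing.Theory.
Local Open Scope ring_scope.

(** Functionals separate points, and pairing any [zeta] with the coadjoint image gives minus a value
    of the cobracket, here [0]. *)
Lemma dual_coad_zero_cobracket (K : fieldType) (g : finLieAlgType K)
    (xi : dual g) (x : g) :
  dual_coad (zero_cobracket g) xi x = 0.
Proof.
apply: dual_separates => zeta.
by rewrite dual_coadE !zero_lfunE oppr0 linear0.
Qed.

Lemma fst_double_zero_cobracket (K : fieldType) (g : finLieAlgType K)
    (X Y : drinfeld_double (zero_cobracket g)) :
  [lie X, Y].1 = [lie X.1, Y.1].
Proof.
(* By conversion, this exposes the first component of [double_bracket]. *)
rewrite -[LHS]/([lie X.1, Y.1] - dual_coad (zero_cobracket g) Y.2 X.1
                + dual_coad (zero_cobracket g) X.2 Y.1).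
by rewrite !dual_coad_zero_cobracket subr0 addr0.
Qed.

Theorem corollary5p7 (k : fieldType) (char0 : [pchar k] =i pred0)
    (g : finLieAlgType k) (q : lieAlgType k) (beta : {biscalar q})
    (phi : g -> {linear q -> q})
    (hphi : equivariant_quasi_Frobenius beta phi) :
  equivariant_quasi_Frobenius beta
    (fun X : drinfeld_double (zero_cobracket g) => phi X.1).
Proof.
case: hphi => qF [phi_linear phi_bracket] phi_der phi_inv.
split=> [//||X|X]; [|exact: phi_der|exact: phi_inv].
(* Addition and scaling on the double are componentwise, so [(a *: X + Y).1] converts to
   [a *: X.1 + Y.1]; only the bracket needs an argument. *)
split=> [a X Y u|X Y u]; first exact: phi_linear.
by rewrite fst_double_zero_cobracket phi_bracket.
Qed.
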